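(* Let $c$ be a positive integer. For any integers $k\ge 2c$ and $t\ge c$, $$N(2,k,t)\ge k(t+2)+c.$$
   Context: For a finite set $X\subset\mathbb{R}^d$, $\mathrm{conv}(X)$ denotes its convex hull (with $\mathrm{conv}(\emptyset)=\emptyset$). For a positive integer $t$, a partition of a finite set $P\subset\mathbb{R}^d$ into $k$ pairwise disjoint subsets $P_1,\dots,P_k$ with union $P$ is called $t$-tolerant if for every set $Y\subset P$ of at most $t$ points, $\bigcap_{i=1}^k \mathrm{conv}(P_i\setminus Y)\neq\emptyset$. For positive integers $d,k,t$, $N(d,k,t)$ denotes the smallest positive integer $N$ such that every set $P$ of $N$ (distinct) points in $\mathbb{R}^d$ can be partitioned into $k$ subsets $P_1,\dots,P_k$ forming a $t$-tolerant partition. (Such an integer always exists.) *)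

(* Defs.v *)
From mathcomp Require Import all_boot all_order all_algebra.
From mathcomp Require Import finmap interval_inference.
From mathcomp Require Import boolp classical_sets reals convex.

Set Implicit Arguments.
Unset Strict Implicit.
Unset Printing Implicit Defensive.

Import Order.TTheory GRing.Theory Num.Theory.

Local Open Scope classical_set_scope.
Local Open Scope ring_scope.

Definition convex_hull (R : numDomainType) (V : lmodType R) (A : set V) :
  set V := smallest (@convex_set R V) A.

Section Tolerance.
Context {R : realType} {d : nat}.
Implicit Type P : {fset 'rV[R]_d}.

(* Parts are allowed to be empty; as the convex hull of the empty set is empty,
   a tolerant partition has no empty part anyway. *)
Definition is_partition k P (Q : 'I_k -> {fset 'rV[R]_d}) : Prop :=
  trivIset [set: 'I_k] (fun i => [set` Q i]) /\
  \bigcup_(i : 'I_k) [set` Q i] = [set` P].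

Definition tolerant k (t : nat) P (Q : 'I_k -> {fset 'rV[R]_d}) : Prop :=
  forall Y : {fset 'rV[R]_d}, (Y `<=` P)%fset -> (#|` Y| <= t)%N ->
    \bigcap_(i : 'I_k) convex_hull [set` (Q i `\` Y)%fset] !=set0.

End Tolerance.

Definition tolerantly_partitionable (R : realType) (d k t N : nat) : Prop :=
  forall P : {fset 'rV[R]_d}, #|` P| = N ->
    exists Q : 'I_k -> {fset 'rV[R]_d}, is_partition P Q /\ tolerant t P Q.

Definition is_tolerant_number (R : realType) (d k t N : nat) : Prop :=
  [/\ (0 < N)%N, tolerantly_partitionable R d k t N &
      forall M, (0 < M)%N -> tolerantly_partitionable R d k t M -> (N <= M)%N].

(* The default value 0 is not used when 0 < k: see tolerant_numberP. *)
Definition tolerant_number (R : realType) (d k t : nat) : nat :=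
  xget 0%N (is_tolerant_number R d k t).

(* Iterating Radon's theorem gives Tverberg-type partitions into 2 ^ m parts, for
   a crude number of points; t + 1 disjoint blocks, each partitioned in this way,
   together give a t-tolerant partition. *)
Section Existence.
Context {R : realType} {d : nat}.
Local Notation V := 'rV[R]_d.
Implicit Type P : {fset V}.

Lemma convex_hullS (A B : set V) :
  A `<=` B -> convex_hull A `<=` convex_hull B.
Proof. by move=> AB x Ax M [cM BM]; apply: Ax; split=> // y /AB/BM. Qed.

Lemma convex_hull_sub (A B : set V) :
  A `<=` convex_hull B -> convex_hull A `<=` convex_hull B.
Proof.
by move=> AB x Ax M [cM BM]; apply: Ax; split=> // y /AB; apply.
Qed.

Lemma convex_comb (A : set V) (I : eqType) (s : seq I) (w : I -> R) (x : I -> V) :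
  convex_set A -> (forall i, i \in s -> 0 <= w i) ->
  (forall i, i \in s -> 0 < w i -> A (x i)) -> 0 < \sum_(i <- s) w i ->
  A ((\sum_(i <- s) w i)^-1 *: \sum_(i <- s) w i *: x i).
Proof.
move=> cA; elim: s => [|i s IH] w0 Ax; first by rewrite big_nil ltxx.
rewrite !big_cons; set W := \sum_(j <- s) w j; set X := \sum_(j <- s) _.
have wi : 0 <= w i by apply: w0; rewrite mem_head.
have ws j : j \in s -> 0 <= w j by move=> js; apply: w0; rewrite inE js orbT.
have As j : j \in s -> 0 < w j -> A (x j).
  by move=> js; apply: Ax; rewrite inE js orbT.
have W0 : 0 <= W by rewrite /W big_seq; apply: sumr_ge0 => j /ws.
move: W0; rewrite le_eqVlt => /orP[/eqP W0|W0].
  have -> : X = 0.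
    rewrite /X big_seq big1 // => j js.
    have /eqP := esym W0; rewrite /W big_seq psumr_eq0; last by move=> l /ws.
    by move=> /allP/(_ j js); rewrite js /= => /eqP->; rewrite scale0r.
  rewrite -W0 !addr0 => wi0; rewrite scalerA mulVf ?gt_eqF// scale1r.
  by apply: Ax => //; rewrite mem_head.
have AX := IH ws As W0.
move: wi; rewrite le_eqVlt => /orP[/eqP wi|wi]; first by rewrite -wi scale0r !add0r.
move=> sW; set p := w i / (w i + W).
have p0 : 0 <= p by rewrite divr_ge0 // ltW.
have p1 : p <= 1 by rewrite ler_pdivrMr // mul1r lerDl ltW.
have Axi : A (x i) by apply: Ax => //; rewrite mem_head.
have := cA (x i) (W^-1 *: X) (Itv01 p0 p1).
rewrite !inE => /(_ Axi AX); rewrite /conv /=; congr A.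
rewrite [LHS](_ : _ = p *: x i + (1 - p) *: (W^-1 *: X)) //.
rewrite scalerDr !scalerA [_^-1 * w i]mulrC; congr (_ + _ *: _).
have -> : 1 - p = W / (w i + W).
  by rewrite /p -{1}(divff (lt0r_neq0 sW)) -mulrBl addrC addKr.
by rewrite mulrAC mulfV ?lt0r_neq0 // mul1r.
Qed.

Lemma radon (x : 'I_d.+2 -> V) : exists (s : 'I_d.+2 -> bool) z,
  forall b, convex_hull [set x j | j in [set j | s j = b]] z.
Proof.
pose M : 'M[R]_(d.+2, 1 + d) := \matrix_(i < d.+2) row_mx (const_mx 1) (x i).
have : kermx M != 0.
  rewrite -mxrank_eq0 mxrank_ker subn_eq0 -ltnNge.
  by rewrite (leq_ltn_trans (rank_leq_col M)).
case/rowV0Pn => l /sub_kermxP lM l0.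
have M1 : \sum_i l 0 i = 0.
  have := congr1 (fun A : 'rV__ => A 0 (lshift d 0)) lM; rewrite !mxE => e.
  rewrite -[RHS]e; apply: eq_bigr => i _; rewrite /M mxE row_mxEl mxE mulr1 //.
have M2 : \sum_i l 0 i *: x i = 0.
  apply/rowP => j; rewrite [RHS]mxE.
  have := congr1 (fun A : 'rV__ => A 0 (rshift 1 j)) lM; rewrite !mxE => e.
  rewrite -[RHS]e summxE; apply: eq_bigr => i _.
  rewrite mxE /M mxE row_mxEr //.
pose w b j := if (0 < l 0 j) == b then `|l 0 j| else 0.
have wl j : w true j - w false j = l 0 j.
  rewrite /w; case: ltrgt0P => // [lj|lj|->]; rewrite ?subr0 ?sub0r ?opprK//.
have W1 : \sum_i w true i = \sum_i w false i.
  by apply/eqP; rewrite -subr_eq0 -sumrB -[X in _ == X]M1; apply/eqP/eq_bigr.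
have W2 : \sum_i w true i *: x i = \sum_i w false i *: x i.
  apply/eqP; rewrite -subr_eq0 -sumrB -[X in _ == X]M2; apply/eqP/eq_bigr => i _.
  by rewrite -scalerBl wl.
have w0 b j : 0 <= w b j by rewrite /w; case: ifP.
have W0 : 0 < \sum_i w true i.
  rewrite lt_def sumr_ge0 // andbT; apply: contra l0 => /eqP W0.
  have z b j : w b j = 0.
    apply/eqP; have : \sum_i w b i == 0 by case: b; rewrite -?W1 W0.
    by rewrite psumr_eq0 // => /allP/(_ j); rewrite mem_index_enum => /(_ isT).
  by apply/eqP/rowP => j; rewrite mxE -wl !z subr0.
exists (fun j => 0 < l 0 j), ((\sum_i w true i)^-1 *: \sum_i w true i *: x i).
move=> b A [cA xA].
have -> : \sum_i w true i = \sum_i w b i by case: b {xA}.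
have -> : \sum_i w true i *: x i = \sum_i w b i *: x i by case: b {xA}.
apply: convex_comb => //; last by case: b {xA}; rewrite -?W1.
move=> i _; rewrite /w; case: eqP => [e _|_]; last by rewrite ltxx.
by apply: xA; exists i.
Qed.

Let coloring m n := forall P, (n <= #|` P|)%N ->
  exists (f : V -> nat) z, forall i, (i < m)%N ->
    convex_hull [set y | y \in P /\ f y = i] z.

Lemma split_fset J n P : (J * n <= #|` P|)%N -> exists g : V -> nat,
  forall j, (j < J)%N -> (n <= #|` [fset y in P | g y == j]%fset|)%N.
Proof.
case: n => [|n] hP; first by exists (fun=> 0%N).
exists (fun y => (index y P %/ n.+1)%N) => j jJ.
pose s := take n.+1 (drop (j * n.+1) P).
have ss : size s = n.+1.
  rewrite size_take size_drop; case: ltnP => // h; apply/eqP.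
  rewrite eqn_leq h /= leq_subRL; last first.
    by apply: leq_trans hP; rewrite leq_mul2r ltnW.
  by rewrite -mulSnr; apply: leq_trans hP; rewrite leq_mul2r jJ orbT.
rewrite -[X in (X <= _)%N]ss; apply: uniq_leq_size.
  by rewrite take_uniq // drop_uniq // fset_uniq.
move=> y ys; have yP : y \in P by apply: mem_drop (mem_take ys).
rewrite !inE /= yP /=.
have /(nthP 0) [i] := ys; rewrite ss => im <-.
rewrite nth_take // nth_drop index_uniq ?fset_uniq //.
  by rewrite divnMDl // divn_small // addn0.
have := ss; rewrite size_take size_drop.
move=> e; have : (n.+1 <= size P - j * n.+1)%N.
  by move: e; case: ltnP => [/ltnW //|_ ->].
by rewrite -ltn_subRL; apply: leq_trans.
Qed.

Lemma coloring_double m n : coloring m n -> coloring (m + m) (d.+2 * n).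
Proof.
move=> cmn P /split_fset[g gP].
have /choice[F FP] : forall j : 'I_d.+2, exists fz : (V -> nat) * V,
    forall i, (i < m)%N ->
    convex_hull [set y | y \in [fset y in P | g y == j]%fset /\ fz.1 y = i] fz.2.
  by move=> j; have [f [z fz]] := cmn _ (gP j (ltn_ord j)); exists (f, z).
have [s [z sz]] := radon (fun j => (F j).2).
exists (fun y => let j := inord (g y) in
  if ((F j).1 y < m)%N then ((F j).1 y + s j * m)%N else (m + m)%N), z.
have key i (b : bool) : (i < m)%N -> convex_hull [set y | y \in P /\
    (let j := inord (g y) in
  if ((F j).1 y < m)%N then ((F j).1 y + s j * m)%N else (m + m)%N) =
   (i + b * m)%N] z.
  move=> im; apply: (convex_hull_sub _ (sz b)) => _ [j /= sj <-].
  apply: (convex_hullS _ (FP j i im)) => y /= [].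
  rewrite !inE /= => /andP[yP /eqP gy] Fy; split => //.
  by rewrite gy inord_val Fy im sj.
move=> i imm; have [im|mi] := ltnP i m.
  by have := key i false im; rewrite mul0n addn0.
have := key (i - m)%N true; rewrite mul1n subnK //; apply.
by rewrite ltn_subLR.
Qed.

Lemma coloring_exists m : exists n, coloring m n.
Proof.
have [n cn] : exists n, coloring (2 ^ m) n.
  elim: m => [|m [n IH]]; last first.
    by exists (d.+2 * n)%N; rewrite expnS mul2n -addnn; exact: coloring_double.
  exists 1%N => P; rewrite cardfs_gt0 => /fset0Pn[y yP].
  exists (fun=> 0%N), y => i; rewrite ltnS leqn0 => /eqP-> A [_]; exact.
exists n => P /cn[f [z fz]]; exists f, z => i im; apply: fz.
by apply: ltn_trans im _; apply: ltn_expl.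
Qed.

Lemma tolerant_exists k t : (0 < k)%N ->
  exists2 N, (0 < N)%N & tolerantly_partitionable R d k t N.
Proof.
case: k => // k _; have [n cn] := coloring_exists k.+1.
exists (t.+1 * n.+1)%N => // P PN.
have /split_fset[g gP] : (t.+1 * n.+1 <= #|` P|)%N by rewrite PN.
have /choice[F FP] : forall j : 'I_t.+1, exists fz : (V -> nat) * V,
    forall i, (i < k.+1)%N ->
    convex_hull [set y | y \in [fset y in P | g y == j]%fset /\ fz.1 y = i] fz.2.
  move=> j; have [f [z fz]] := cn _ (ltnW (gP j (ltn_ord j))).
  by exists (f, z).
pose h y : 'I_k.+1 := inord ((F (inord (g y))).1 y).
exists (fun i => [fset y in P | h y == i]%fset); split.
  split=> [i j _ _ [y [/=]]|].
    by rewrite !inE => /andP[_ /eqP <-] /andP[_ /eqP <-].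
  apply/seteqP; split => y /= => [[i _ /=]|yP]; first by rewrite !inE => /andP[].
  by exists (h y); rewrite //= !inE yP eqxx.
move=> Y _ Yt.
have [j gj] : exists j : 'I_t.+1, forall y, y \in Y -> g y != j.
  apply: contrapT => nj.
  suff : (t.+1 <= #|` Y|)%N by rewrite ltnNge Yt.
  rewrite -(size_iota 0 t.+1) -(size_map g); apply: uniq_leq_size.
    exact: iota_uniq.
  move=> j; rewrite mem_iota /= => jt; apply/negPn/negP => jY; apply: nj.
  exists (Ordinal jt) => y yY; apply: contra jY => /eqP /= <-.
  exact: map_f.
exists (F j).2 => i _; apply: (convex_hullS _ (FP j i (ltn_ord i))) => y /= [].
rewrite !inE /= => /andP[yP /eqP gy] Fy; apply/and3P; split => //.
  by apply/negP => /gj; rewrite gy eqxx.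
by apply/eqP/val_inj; rewrite /h gy inord_val Fy inord_val.
Qed.

End Existence.

Lemma tolerant_numberP (R : realType) (d k t : nat) : (0 < k)%N ->
  is_tolerant_number R d k t (tolerant_number R d k t).
Proof.
move=> /(@tolerant_exists R d k t)[N N0 NP].
pose p N := (0 < N)%N && `[< tolerantly_partitionable R d k t N >].
have pe : exists N, p N by exists N; rewrite /p N0; apply/asboolP.
apply: (@xgetPex _ _ (is_tolerant_number R d k t)).
exists (ex_minn pe); case: ex_minnP => M /andP[M0 /asboolP MP] minM; split=> // M'.
by move=> M'0 M'P; apply: minM; rewrite /p M'0; apply/asboolP.
Qed.

(* Main.v *)
(* Put k(t+2) - 1 points on a parabola and c points deep inside it. Among k parts,
   some part A has at most t + 1 points, or exactly t + 2 points, all of them on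
   the parabola (this uses 2c <= k). In the second case the points of A cut the
   closed curve into t + 2 gaps containing at most (k-1)(t+2) - 1 other points
   of the parabola, so some gap misses a part B other than A. Deleting the t
   points of A other than the two ends of that gap leaves a chord, and the inner
   points are so deep that its line separates it from B. If A has t + 1 points,
   one of them is on the parabola because c <= t, and it plays the role of a
   degenerate chord. *)
Require Import Defs.
From mathcomp Require Import all_boot reals.
From mathcomp Require Import all_order all_algebra finmap interval_inference.
From mathcomp Require Import boolp classical_sets convex zify ring lra.

Set Implicit Arguments.
Unset Strict Implicit.
Unset Printing Implicit Defensive.

Import Order.TTheory GRing.Theory Num.Theory.

(** * Combinatorics of colored indices *)

Lemma sum_count_color (T : Type) (k : nat) (f : T -> 'I_k) (s : seq T) :
  \sum_(a < k) count (fun x => f x == a) s = size s.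
Proof.
elim: s => [|x s IH] /=; first by rewrite big1.
rewrite big_split /= IH (bigD1 (f x)) //= eqxx big1 ?addn0 // => a /negbTE.
by rewrite eq_sym => ->.
Qed.

Lemma missing_color (T : Type) (k : nat) (f : T -> 'I_k) (a : 'I_k)
    (s : seq T) : (size s).+1 < k ->
  exists2 b, b != a & b \notin map f s.
Proof.
move=> sk; apply: contrapT => nb.
suff : k <= size (a :: map f s) by rewrite /= size_map leqNgt sk.
rewrite -[X in X <= _]size_enum_ord; apply: uniq_leq_size; first exact: enum_uniq.
move=> b _; rewrite inE; case: eqVneq => //= ba.
by apply/negPn/negP => bs; apply: nb; exists b.
Qed.

Section Coloring.
Variables (k t c N : nat) (f : nat -> 'I_k).
Hypotheses (c_gt0 : 0 < c) (ck : 2 * c <= k) (ct : c <= t).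
Let m := k * (t + 2).
Hypothesis Nm : N < m + c.

Let part a := [seq l <- iota 0 N | f l == a].

Let mem_part a l : (l \in part a) = (f l == a) && (l < N).
Proof. by rewrite mem_filter mem_iota add0n. Qed.

(** Double counting: if no color were tight, every part would have at least [t + 3] elements once
    inner indices count twice. But the total is at most [N + c], which is less than
    [m + 2 * c <= k * (t + 3)]. *)
Lemma exists_tight_color : (forall a, t + 2 <= size (part a)) ->
  exists2 a, size (part a) = t + 2 & forall l, l \in part a -> l.+1 < m.
Proof.
move=> part_ge; apply: contrapT => ntight.
pose inner := [seq l <- iota 0 N | m <= l.+1].
have inner_le : size inner <= c.
  rewrite -(size_iota m.-1 c); apply: uniq_leq_size.
    by rewrite filter_uniq ?iota_uniq.
  move=> l; rewrite mem_filter !mem_iota; lia.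
have : \sum_(a < k) (t + 3) <=
    \sum_(a < k) (count (fun l => f l == a) (iota 0 N) +
                  count (fun l => f l == a) inner).
  apply: leq_sum => a _; rewrite -size_filter -/(part a).
  have [pa|ne] := eqVneq (size (part a)) (t + 2); last first.
    by have := part_ge a; lia.
  have [l la lm] : exists2 l, l \in part a & m <= l.+1.
    apply: contrapT => nl; apply: ntight; exists a => // l la.
    by rewrite ltnNge; apply/negP => lm; apply: nl; exists l.
  move: la; rewrite mem_part => /andP[fl lN].
  suff : 0 < count (fun l => f l == a) inner by lia.
  rewrite -has_count; apply/hasP; exists l => //.
  by rewrite mem_filter lm mem_iota.
rewrite sum_nat_const card_ord big_split /= !sum_count_color size_iota.
have := Nm; rewrite /m; nia.
Qed.

Let rest_size a (s : seq nat) n : uniq s -> {subset s <= part a} ->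
  size (part a) <= size s + n ->
  size [seq l <- part a | l \notin s] <= n.
Proof.
move=> us sa; rewrite size_filter => le.
pose q : pred nat := fun l => l \in s.
have : size s <= count q (part a).
  rewrite -size_filter; apply: uniq_leq_size => // l ls.
  by rewrite mem_filter sa // andbT.
have := count_predC q (part a).
have -> : count (fun l => l \notin s) (part a) = count (predC q) (part a).
  exact: eq_count.
by set x := count q _; set y := count _ _; lia.
Qed.

(* The index l stands for a point of the parabola if l.+1 < m, and for an inner
   point otherwise. The last disjunct is the gap closing the curve, which goes
   from j through the last and first points of the parabola to i. *)
Lemma exists_cap :
  (exists a, size (part a) <= t) \/
  exists a b i j, [/\ i <= j, j.+1 < m,
    size [seq l <- part a | l \notin [:: i; j]] <= t &
    (j < i + k /\
      forall l, l < N -> l.+1 < m -> f l = b -> (l < i) || (j < l)) \/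
    [/\ i.+1 < k, m <= j + k &
      forall l, l < N -> l.+1 < m -> f l = b -> i < l < j]].
Proof.
have [[a ?]|big] := pselect (exists a, size (part a) <= t).
  by left; exists a.
right; have {}big a : t < size (part a).
  by rewrite ltnNge; apply/negP => ?; apply: big; exists a.
have [[a pa]|huge] := pselect (exists a, size (part a) = t.+1).
  have [i ia im] : exists2 i, i \in part a & i.+1 < m.
    apply: contrapT => ni; have : size (part a) <= size (iota m.-1 c).
      apply: uniq_leq_size; first by rewrite filter_uniq ?iota_uniq.
      move=> l la; have := la; rewrite mem_part mem_iota => /andP[_ lN].
      have : ~ l.+1 < m by move=> lm; apply: ni; exists l.
      lia.
    by rewrite size_iota pa; lia.
  have [|b ba _] := @missing_color _ k f a [::]; first by rewrite /=; lia.
  (* With equal ends the chord becomes the tangent at [i], so any color [b] other than [a] will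
     do. *)
  exists a, b, i, i; split => //.
    rewrite (eq_filter (a2 := fun l => l \notin [:: i])); last first.
      by move=> l; rewrite !inE orbb.
    by apply: rest_size => //=; [move=> l; rewrite inE => /eqP->|rewrite pa].
  left; split=> [|l _ _ fl]; first lia.
  rewrite -neq_ltn; apply: contraNneq ba => li.
  by move: ia; rewrite mem_part -fl li => /andP[].
have [a pa am] : exists2 a, size (part a) = t + 2 &
    forall l, l \in part a -> l.+1 < m.
  apply: exists_tight_color => a; have := big a.
  have : size (part a) <> t.+1 by move=> ?; apply: huge; exists a.
  lia.
pose p l := nth 0 (part a) l.
have pP l : l < t + 2 -> p l \in part a by rewrite -pa; apply: mem_nth.
have pf l : l < t + 2 -> f (p l) = a.
  by move=> /pP; rewrite mem_part => /andP[/eqP].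
have p_mono l l' : l' < t + 2 -> l < l' -> p l < p l'.
  rewrite -pa => lt ll; apply: (sorted_ltn_nth ltn_trans); rewrite ?inE //.
  - by apply: sorted_filter; [exact: ltn_trans|exact: iota_ltn_sorted].
  - exact: ltn_trans lt.
have rest l l' : l < l' -> l' < t + 2 ->
    size [seq x <- part a | x \notin [:: p l; p l']] <= t.
  move=> ll lt; apply: rest_size; last by rewrite pa addnC.
    by rewrite /= inE andbT neq_ltn p_mono.
  by move=> x; rewrite !inE => /orP[]/eqP ->; apply: pP; lia.
(* Two consecutive elements of the part less than [k] apart have at most [k - 2] indices between
   them, so these and [a] do not exhaust the colors. *)
have [[l lt gap]|wide] := pselect (exists2 l, l.+1 < t + 2 & p l.+1 < p l + k).
  have pl := p_mono _ _ lt (ltnSn l).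
  have [|b ba nb] := @missing_color _ k f a (iota (p l).+1 (p l.+1 - (p l).+1)).
    by rewrite size_iota; lia.
  exists a, b, (p l), (p l.+1); split; [exact: ltnW|exact/am/pP|exact: rest|].
  left; split => // x _ _ fx; apply: contraNT nb => xl.
  apply/mapP; exists x => //.
  have nx y : y < t + 2 -> x <> p y.
    by move=> yt xy; move: ba; rewrite -fx xy pf ?eqxx.
  have := nx l; have := nx l.+1; rewrite mem_iota; lia.
(* Otherwise the [t + 1] steps, each at least [k], span so much that at most [k - 2] of the [m - 1]
   indices on the parabola lie outside, and the closing gap misses a color. *)
have p_ge l : l < t + 2 -> p 0 + k * l <= p l.
  elim: l => [|l IH] lt; first by rewrite muln0 addn0.
  have : ~ p l.+1 < p l + k by move=> ?; apply: wide; exists l.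
  have := IH (ltnW lt).
  lia.
have p_gap : p 0 + k * t.+1 <= p t.+1 by apply: p_ge; lia.
have p_m : (p t.+1).+1 < m by apply/am/pP; lia.
have mE : m = k * t.+1 + k by rewrite /m; lia.
have [|b ba nb] := @missing_color _ k f a
    (iota 0 (p 0) ++ iota (p t.+1).+1 (m.-1 - (p t.+1).+1)).
  rewrite size_cat !size_iota; lia.
exists a, b, (p 0), (p t.+1); split => //; [lia|apply: rest; lia|].
right; split; [lia|lia|] => x _ xm fx.
apply: contraNT nb => xl; apply/mapP; exists x => //.
have nx y : y < t + 2 -> x <> p y.
  by move=> yt xy; move: ba; rewrite -fx xy pf ?eqxx.
have := nx 0; have := nx t.+1; rewrite mem_cat !mem_iota; lia.
Qed.

End Coloring.

Local Open Scope classical_set_scope.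
Local Open Scope ring_scope.

(** * Separation by an affine function *)

(** The sets [g <= 0] and [0 < g] are disjoint and both convex. *)
Lemma hull_separated (R : realDomainType) (V : lmodType R) (g : V -> R)
    (A B : set V) :
  (forall x y p, g (p *: x + (1 - p) *: y) = p * g x + (1 - p) * g y) ->
  (forall x, A x -> g x <= 0) -> (forall x, B x -> 0 < g x) ->
  forall z, convex_hull A z -> ~ convex_hull B z.
Proof.
move=> gE gA gB z Az Bz.
have : g z <= 0.
  apply: (Az [set x | g x <= 0]); split; last exact: gA.
  move=> x y p; rewrite !inE /= /conv /= => gx gy.
  have [p0 p1] : 0 <= p%:num /\ p%:num <= 1 by [].
  rewrite [X in g X](_ : _ = p%:num *: x + (1 - p%:num) *: y) // gE.
  by rewrite -oppr_ge0 opprD -!mulrN addr_ge0 ?mulr_ge0 ?oppr_ge0 ?subr_ge0.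
apply/negP; rewrite -ltNge.
apply: (Bz [set x | 0 < g x]); split; last exact: gB.
move=> x y p; rewrite !inE /= /conv /= => gx gy.
have [p0 p1] : 0 <= p%:num /\ p%:num <= 1 by [].
rewrite [X in g X](_ : _ = p%:num *: x + (1 - p%:num) *: y) // gE.
(* Strict positivity comes from [p * g x], except at [p = 0], where it comes from [g y]. *)
move: p0; rewrite le_eqVlt => /orP[/eqP <-|p0].
  by rewrite mul0r add0r subr0 mul1r.
by rewrite ltr_wpDr ?mulr_gt0 // mulr_ge0 ?subr_ge0 // ltW.
Qed.

(** * The parabola, its chords and the inner points *)

Section Configuration.
Variables (R : realDomainType) (k m : nat).

Definition point (x y : R) : 'rV[R]_2 := \row_j (if j == 0 then x else y).

(* Doubling i makes the values for 0 <= i <= m - 2 symmetric about 0 without halves. *)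
Definition abscissa (i : nat) : R := (2 * i.+1)%:R - m%:R.

(* The height k ^ 2 puts the inner points above the chords joining indices less
   than k apart, and below those joining one of the first k - 1 points of the
   parabola to one of the last k - 1, as long as 3 * k <= m. *)
Definition config (i : nat) : 'rV[R]_2 :=
  if (i.+1 < m)%N then point (abscissa i) (abscissa i ^+ 2)
  else point 0 (k ^ 2 + (i.+1 - m))%:R.

(** Vanishes on the line meeting the parabola at abscissas [u] and [v] (the tangent if [u = v]) and
    is positive above it. At [(x, x ^ 2)] it equals [(u - x) * (v - x)]. *)
Definition chord (u v : R) (p : 'rV[R]_2) : R :=
  p 0 1 - (u + v) * p 0 0 + u * v.

Lemma point_inj x y x' y' : point x y = point x' y' -> x = x' /\ y = y'.
Proof.
move=> e; have := congr1 (fun p : 'rV_2 => p 0 0) e.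
by have := congr1 (fun p : 'rV_2 => p 0 1) e; rewrite !mxE.
Qed.

Lemma chord_point u v x y : chord u v (point x y) = y - (u + v) * x + u * v.
Proof. by rewrite /chord !mxE. Qed.

Lemma chord_affine u v x y p :
  chord u v (p *: x + (1 - p) *: y) = p * chord u v x + (1 - p) * chord u v y.
Proof. by rewrite /chord !mxE; ring. Qed.

(** The parabola meets the axis carrying the inner points only at height 0, and inner heights are
    positive. *)
Lemma config_inj : (0 < k)%N -> injective config.
Proof.
move=> k0 i j; rewrite /config.
have pos n : (k ^ 2 + n)%:R != 0 :> R.
  by rewrite pnatr_eq0 -lt0n ltn_addr // expn_gt0 k0.
case: ifP => im; case: ifP => jm /point_inj[].
- by move=> /addIr /eqP; rewrite eqr_nat => ? _; lia.
- by move=> -> /esym/eqP; rewrite expr0n /= (negbTE (pos _)).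
- by move=> <- /eqP; rewrite expr0n /= (negbTE (pos _)).
- by move=> _ /eqP; rewrite eqr_nat; lia.
Qed.

Lemma abscissa_lt i j : (i < j)%N -> abscissa i < abscissa j.
Proof. by move=> ij; rewrite ltrD2r ltr_nat; lia. Qed.

Lemma chord_narrow i j l : (i <= j)%N -> (j < i + k)%N ->
    ((l.+1 < m)%N -> (l < i)%N || (j < l)%N) ->
  0 < chord (abscissa i) (abscissa j) (config l).
Proof.
move=> ij jk; rewrite /config; case: ifP => lm; rewrite chord_point.
  move=> /(_ isT) lij.
  have -> : abscissa l ^+ 2 - (abscissa i + abscissa j) * abscissa l +
      abscissa i * abscissa j =
      (abscissa i - abscissa l) * (abscissa j - abscissa l) by ring.
  case/orP: lij => lij; [apply: mulr_gt0|rewrite nmulr_rgt0];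
    by rewrite ?subr_gt0 ?subr_lt0; apply: abscissa_lt; lia.
move=> _; rewrite mulr0 subr0 natrD natrX.
have s0 : 0 <= (l.+1 - m)%:R :> R by exact: ler0n.
have k1 : 1 <= k%:R :> R by rewrite ler1n; lia.
have uv : abscissa i <= abscissa j by rewrite lerD2r ler_nat; lia.
have vu : abscissa j + 2 <= abscissa i + 2 * k%:R.
  by rewrite /abscissa addrAC [leRHS]addrAC lerD2r -natrM -!natrD ler_nat; lia.
move: (abscissa i) (abscissa j) uv vu => u v uv vu.
(* Since [4 * u * v = (u + v) ^ 2 - (v - u) ^ 2] and [v - u <= 2 * (k - 1)], the product [u * v] is
   at least [- (k - 1) ^ 2], which the height [k ^ 2] outweighs. *)
have : 0 <= (2 * k%:R - 2 - (v - u)) * (2 * k%:R - 2 + (v - u)).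
  by apply: mulr_ge0; lra.
have := sqr_ge0 (u + v); nra.
Qed.

Lemma chord_wide i j l : (3 * k <= m)%N -> (i.+1 < k)%N -> (m <= j + k)%N ->
    (2 * (l.+1 - m) <= k)%N -> ((l.+1 < m)%N -> (i < l < j)%N) ->
  chord (abscissa i) (abscissa j) (config l) < 0.
Proof.
move=> km ik jk lk; rewrite /config; case: ifP => lm; rewrite chord_point.
  move=> /(_ isT) /andP[il lj].
  have -> : abscissa l ^+ 2 - (abscissa i + abscissa j) * abscissa l +
      abscissa i * abscissa j =
      (abscissa i - abscissa l) * (abscissa j - abscissa l) by ring.
  by rewrite nmulr_rlt0 ?subr_gt0 ?subr_lt0; apply: abscissa_lt.
move=> _; rewrite mulr0 subr0 natrD natrX.
have sk : 2 * (l.+1 - m)%:R <= k%:R :> R by rewrite -natrM ler_nat.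
have k1 : 1 <= k%:R :> R by rewrite ler1n; lia.
have u_le : abscissa i <= - (k%:R + 2).
  rewrite /abscissa lerBlDr addrC -lerBlDr opprK -!natrD ler_nat; lia.
have v_ge : k%:R + 2 <= abscissa j.
  by rewrite /abscissa lerBrDr -!natrD ler_nat; lia.
move: (abscissa i) (abscissa j) u_le v_ge => u v u_le v_ge.
(* An inner height is at most [k ^ 2 + k / 2], below [(k + 2) ^ 2 <= - u * v]. *)
have : (k%:R + 2) * (k%:R + 2) <= (- u) * v.
  by apply: ler_pM; lra.
nra.
Qed.

End Configuration.

(** * Every partition of the configuration fails to be tolerant *)

Lemma config_not_tolerant (R : realType) (c k t N : nat) :
    (0 < c)%N -> (2 * c <= k)%N -> (c <= t)%N -> (N < k * (t + 2) + c)%N ->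
  ~ tolerantly_partitionable R 2 k t N.
Proof.
move=> c0 ck ct Nm; have k0 : (0 < k)%N by lia.
set m := (k * (t + 2))%N in Nm.
have cfg_inj : injective (@config R k m) by exact: config_inj.
pose pts s := [fset p | p in map (@config R k m) s]%fset.
have ptsP s p : reflect (exists2 l, l \in s & p = config R k m l) (p \in pts s).
  by rewrite inE /=; apply: mapP.
have pts_le s : (#|` pts s| <= size s)%N.
  by rewrite card_fseq (leq_trans (size_undup _)) // size_map.
move=> /(_ (pts (iota 0 N))) [].
  by rewrite card_fseq undup_id ?size_map ?size_iota // map_inj_uniq ?iota_uniq.
move=> Q [[Qtriv Qcover] Qtol].
(* The partition becomes a coloring of indices; the color of an index from [N] on is arbitrary. *)
have /choice[f fP] l : exists a : 'I_k, (l < N)%N -> config R k m l \in Q a.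
  have [lN|_] := ltnP l N; last by exists (Ordinal k0).
  have : [set` pts (iota 0 N)] (config R k m l).
    by apply/ptsP; exists l; rewrite ?mem_iota.
  by rewrite -Qcover => -[a _ aP]; exists a.
have QP a p : p \in Q a -> exists l, [/\ (l < N)%N, f l = a & p = config R k m l].
  move=> pa; have : [set` pts (iota 0 N)] p by rewrite -Qcover; exists a.
  move=> /ptsP [l]; rewrite mem_iota => /andP[_ lN] pE; exists l; split => //.
  by apply: Qtriv => //; exists p; split; rewrite /= ?pE ?fP // -pE.
have sub s : {subset s <= iota 0 N} -> (pts s `<=` pts (iota 0 N))%fset.
  by move=> sN; apply/fsubsetP => p /ptsP[l /sN lN ->]; apply/ptsP; exists l.
(* Deleting the points indexed by [s] refutes tolerance as soon as [g] separates what is left of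
   part [a] from part [b]. *)
have sep s a b (g : 'rV[R]_2 -> R) : {subset s <= iota 0 N} -> (size s <= t)%N ->
    (forall x y p, g (p *: x + (1 - p) *: y) = p * g x + (1 - p) * g y) ->
    (forall l, (l < N)%N -> f l = a -> l \notin s -> g (config R k m l) <= 0) ->
    (forall l, (l < N)%N -> f l = b -> 0 < g (config R k m l)) -> False.
  move=> sN st gE ga gb.
  have [z zP] := Qtol _ (sub s sN) (leq_trans (pts_le s) st).
  apply: (hull_separated gE) (zP a I) (zP b I) => p /=;
    rewrite in_fsetD => /andP[ps /QP[l [lN fl pE]]]; rewrite pE.
    by apply: ga => //; apply: contra ps => ls; apply/ptsP; exists l.
  exact: gb.
have part_sub a (q : pred nat) :
    {subset [seq l <- [seq l <- iota 0 N | f l == a] | q l] <= iota 0 N}.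
  by move=> l; rewrite !mem_filter => /and3P[].
have [[a at_]|[a [b [i [j [ij jm rest cap]]]]]] := exists_cap f c0 ck ct Nm.
  (* A part of at most [t] points is deleted entirely, so the bound on what is left of it holds
     vacuously, even for the constant 1. *)
  apply: (sep [seq l <- iota 0 N | f l == a] a a (fun=> 1)) => //.
  - by move=> l; rewrite mem_filter => /andP[].
  - by move=> _ _ p; ring.
  - by move=> l lN fl; rewrite mem_filter fl eqxx mem_iota lN.
have on_chord l : l \in [:: i; j] ->
    chord (abscissa R m i) (abscissa R m j) (config R k m l) = 0.
  have im : (i.+1 < m)%N by lia.
  by rewrite !inE => /orP[]/eqP ->; rewrite /config ?im ?jm chord_point; ring.
have in_rest l : (l < N)%N -> f l = a ->
    l \notin [seq l <- [seq l <- iota 0 N | f l == a] | l \notin [:: i; j]] ->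
  l \in [:: i; j].
  by move=> lN fl; rewrite !mem_filter fl eqxx mem_iota lN !andbT negbK.
case: cap => [[jk nb]|[ik jk nb]].
  apply: (sep _ a b (chord (abscissa R m i) (abscissa R m j))
    (part_sub a _) rest).
  - exact: chord_affine.
  - by move=> l lN fl /(in_rest _ lN fl) /on_chord ->.
  - by move=> l lN fl; apply: chord_narrow => // lm; apply: nb.
(* For the closing gap, part [b] lies below the chord, hence the sign. *)
apply: (sep _ a b (fun p => - chord (abscissa R m i) (abscissa R m j) p)
  (part_sub a _) rest).
- by move=> x y p; rewrite chord_affine; ring.
- by move=> l lN fl /(in_rest _ lN fl) /on_chord ->; rewrite oppr0.
- move=> l lN fl; rewrite oppr_gt0; apply: chord_wide => //.
  (* Here [3 * k <= m] because [1 <= c <= t]; the next bound holds because [l < N < m + c] and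
     [2 * c <= k]. *)
  + by rewrite /m; nia.
  + by lia.
  + by move=> lm; apply: nb.
Qed.

Local Close Scope ring_scope.
Local Close Scope classical_set_scope.

Theorem theorem6 (R : realType) (c k t : nat) (hc : 0 < c) (hk : 2 * c <= k)
    (ht : c <= t) :
  k * (t + 2) + c <= tolerant_number R 2 k t.
Proof.
have [|_ partN _] := @tolerant_numberP R 2 k t; first lia.
rewrite leqNgt; apply/negP => Nm; exact: config_not_tolerant hc hk ht Nm partN.
Qed.
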